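(* Let $\mathbb F$ be a field and $n\ge4$. Let $\mathcal C_1,\dots,\mathcal C_{n-2}\subseteq\mathrm{Mat}(2,\mathbb F)$ be $2$-dimensional $\mathbb F$-linear subspaces all of whose nonzero elements are invertible ($[2\times2,2,2]_{\mathbb F}$ MRD codes), and let $\mathcal C_{n-1}\subseteq\mathbb F^n$ be an $[n,n-3,4]_{\mathbb F}$ MDS code. For $i\in\{1,\dots,n-2\}$ put $\overline{\mathcal C}_i=\phi_{i,i+1}(\mathcal C_i)$, let $\overline{\mathcal C}_{n-1}=\psi(\mathcal C_{n-1})$, and let $\overline{\mathrm U}(n-3,\mathbb F)=\phi_{1,4}(\mathrm U(n-3,\mathbb F))$. Then $$\mathcal C=\overline{\mathcal C}_1+\dots+\overline{\mathcal C}_{n-2}+\overline{\mathcal C}_{n-1}+\overline{\mathrm U}(n-3,\mathbb F)$$ is an $\{n,\frac{n(n+1)}{2}-4,4\}_{\mathbb F}$ maximum flag-rank distance code.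
   Context: $\mathrm{U}(m,\mathbb F)$ is the space of $m\times m$ upper triangular matrices over $\mathbb F$. For $M\in\mathrm{U}(n,\mathbb F)$, $M_{[i]}$ is the submatrix with rows $1,\dots,i$ and columns $i,\dots,n$, and $\mathrm{w}_{\mathrm{fr}}(M)=\sum_{i=1}^n\operatorname{rk}(M_{[i]})$. An $\{n,t,\delta\}_{\mathbb F}$ code is a $t$-dimensional subspace of $\mathrm{U}(n,\mathbb F)$ whose minimum $\mathrm{w}_{\mathrm{fr}}$ over nonzero elements is $\delta$; it is maximum flag-rank distance (MFRD) if $t=n(n+1)/2-g(\delta)$, where $g(\delta)=\delta-1+\lfloor\sqrt{\delta-1}\rfloor\cdot\lfloor(\sqrt{4(\delta-1)+1}-1)/2\rfloor$ (so $g(4)=4$). An $[n,n-3,4]_{\mathbb F}$ MDS code is an $(n-3)$-dimensional subspace of $\mathbb F^n$ all of whose nonzero vectors have at least $4$ nonzero coordinates. $\psi:\mathbb F^n\to\mathrm{U}(n,\mathbb F)$ maps $v$ to the diagonal matrix with diagonal $v$. For $\ell,i,j\ge1$ with $i+\ell-1\le n$ and $j+\ell-1\le n$, $\phi_{i,j}:\mathrm{Mat}(\ell,\mathbb F)\to\mathrm{Mat}(n,\mathbb F)$ places an $\ell\times\ell$ matrix in rows $i,\dots,i+\ell-1$ and columns $j,\dots,j+\ell-1$, with zeros elsewhere (here $\ell=2$ for $\phi_{i,i+1}$ and $\ell=n-3$ for $\phi_{1,4}$). *)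

(* Defs.v *)
From HB Require Import structures.
From mathcomp Require Import all_boot all_order all_algebra all_field.

Set Implicit Arguments.
Unset Strict Implicit.
Unset Printing Implicit Defensive.

Import Order.TTheory GRing.Theory Num.Theory.
Local Open Scope ring_scope.

(* All row and column indices are 0-based. *)

Section Maps.

Variable F : fieldType.

Definition strict_lower (m : nat) (A : 'M[F]_m) : 'M[F]_m :=
  \matrix_(i, j) (if (j < i)%N then A i j else 0).

Fact strict_lower_is_linear (m : nat) : linear (@strict_lower m).
Proof.
move=> a A B; apply/matrixP=> i j; rewrite !mxE.
by case: ifP => _; rewrite ?mulr0 ?addr0.
Qed.

HB.instance Definition _ (m : nat) :=
  GRing.isLinear.Build F 'M[F]_m 'M[F]_m _ (@strict_lower m)
    (@strict_lower_is_linear m).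

Definition upper_mx (m : nat) : {vspace 'M[F]_m} :=
  lker (linfun (@strict_lower m)).

Lemma upper_mxP (m : nat) (A : 'M[F]_m) :
  reflect (forall i j : 'I_m, (j < i)%N -> A i j = 0) (A \in upper_mx m).
Proof.
rewrite memv_ker lfunE /=; apply: (iffP eqP) => [/matrixP A0 i j ji|A0].
  by have := A0 i j; rewrite !mxE ji.
by apply/matrixP=> i j; rewrite !mxE; case: ifP => // /A0.
Qed.

(* Entry (k, m) of [A] goes to position (i + k, j + m). *)
Definition phi_mx (l n i j : nat) (A : 'M[F]_l) : 'M[F]_n :=
  \matrix_(r, c) \sum_(k < l) \sum_(m < l | (i + k == r)%N && (j + m == c)%N)
    A k m.

Fact phi_mx_is_linear (l n i j : nat) : linear (@phi_mx l n i j).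
Proof.
move=> a A B; apply/matrixP=> r c; rewrite !mxE mulr_sumr -big_split /=.
apply: eq_bigr => k _; rewrite mulr_sumr -big_split /=.
by apply: eq_bigr => m _; rewrite !mxE.
Qed.

HB.instance Definition _ (l n i j : nat) :=
  GRing.isLinear.Build F 'M[F]_l 'M[F]_n _ (@phi_mx l n i j)
    (@phi_mx_is_linear l n i j).

Definition phi (l n i j : nat) : 'Hom('M[F]_l, 'M[F]_n) :=
  linfun (@phi_mx l n i j).

Lemma phi_in (l n i j : nat) (A : 'M[F]_l) (r c : 'I_n) (k m : 'I_l) :
  r = (i + k)%N :> nat -> c = (j + m)%N :> nat -> phi l n i j A r c = A k m.
Proof.
move=> rE cE; rewrite lfunE mxE (bigD1 k) //= (bigD1 m) /=; last by rewrite rE cE !eqxx.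
rewrite !big1 ?addr0 // => [k'|m'].
  move=> k'k; rewrite big_pred0 // => m'.
  by rewrite rE eqn_add2l (inj_eq val_inj) (negPf k'k).
by rewrite cE eqn_add2l (inj_eq val_inj) => /andP[/andP[_ ->]].
Qed.

Lemma phi_out (l n i j : nat) (A : 'M[F]_l) (r c : 'I_n) :
  ~~ ((i <= r < i + l) && (j <= c < j + l))%N -> phi l n i j A r c = 0.
Proof.
move=> out; rewrite lfunE mxE big1 // => k _; rewrite big_pred0 // => m.
apply: contraNF out => /andP[/eqP <- /eqP <-].
by rewrite !leq_addr !ltn_add2l !ltn_ord.
Qed.

Definition psi (n : nat) : 'Hom('rV[F]_n, 'M[F]_n) := linfun (@diag_mx F n).

End Maps.

Section Codes.

Variable F : fieldType.

(* Rows 0..i and columns i..n-1 of [M]. *)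
Definition flag_submx (n : nat) (M : 'M[F]_n) (i : 'I_n) :
    'M[F]_(i.+1, n - i) :=
  mxsub (widen_ord (ltn_ord i))
    (fun b : 'I_(n - i) => cast_ord (subnKC (ltnW (ltn_ord i))) (rshift i b)) M.

Definition flag_rank (n : nat) (M : 'M[F]_n) : nat :=
  (\sum_(i < n) \rank (flag_submx M i))%N.

Definition flag_rank_code (n t delta : nat) (C : {vspace 'M[F]_n}) : Prop :=
  [/\ (C <= upper_mx F n)%VS,
      \dim C = t,
      forall M, M \in C -> M != 0 -> (delta <= flag_rank M)%N
    & exists M, [/\ M \in C, M != 0 & flag_rank M = delta]].

Definition g (delta : nat) : nat :=
  (delta - 1 + Num.truncn (sqrtC (delta - 1)%:R : algC)
    * Num.truncn ((sqrtC (4 * (delta - 1) + 1)%:R - 1) / 2 : algC))%N.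

(* [t = n (n + 1) / 2 - g delta], without truncated subtraction. *)
Definition mfrd_code (n t delta : nat) (C : {vspace 'M[F]_n}) : Prop :=
  flag_rank_code t delta C /\ (t + g delta = (n * n.+1) %/ 2)%N.

Definition mrd_2x2_2_2 (C : {vspace 'M[F]_2}) : Prop :=
  \dim C = 2%N /\ forall A, A \in C -> A != 0 -> A \in unitmx.

Definition hamming_weight (n : nat) (v : 'rV[F]_n) : nat :=
  #|[set j | v 0 j != 0]|.

Definition mds_code (n k d : nat) (D : {vspace 'rV[F]_n}) : Prop :=
  [/\ (k + d = n.+1)%N, \dim D = k
    & forall v, v \in D -> v != 0 -> (d <= hamming_weight v)%N].

End Codes.

Lemma g4 : g 4 = 4%N.
Proof.
rewrite /g.
have -> : Num.truncn (sqrtC (4 - 1)%:R : algC) = 1%N.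
  apply: truncn_def; rewrite -[X in X <= _]sqrtC1 -[X in _ < X](sqrCK (ler0n _ 2)).
  by rewrite ler_sqrtC ?ltr_sqrtC ?qualifE /= ?ler0n ?exprn_ge0 ?ler0n //
     -natrX ler1n ltr_nat.
have -> // : Num.truncn ((sqrtC (4 * (4 - 1) + 1)%:R - 1) / 2 : algC) = 1%N.
apply: truncn_def; rewrite ler_pdivlMr ?ltr0n // ltr_pdivrMr ?ltr0n //.
rewrite mul1r lerBrDr ltrBlDr -[1]/(1%:R) -!natrM -!natrD.
rewrite -[X in X <= _](sqrCK (ler0n _ _)) -[X in _ < X](sqrCK (ler0n _ _)).
by rewrite -!natrX ler_sqrtC ?ltr_sqrtC ?qualifE /= ?ler0n // ler_nat ltr_nat.
Qed.

(* Main.v *)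
(* An entry in position (r, c) of a matrix M lies in M_[i] for all r <= i <= c,
   so one nonzero entry on the third superdiagonal or above already gives weight
   at least 4.  Otherwise M is the sum of the 2x2 blocks A_i and diag(v).  The
   entry (i, i+2) of M is the corner of A_i alone.
   - Two blocks with nonzero corner give four nonzero ranks.
   - If no corner is nonzero, every nonzero A_i is invertible and lower
     triangular.  The first and the last nonzero A_i then give uncancelled
     entries on the superdiagonal; if they are the same block, it has rank 2 in
     the middle flag submatrix.
   - If only A_m has a nonzero corner, the three submatrices that meet it are
     nonzero.  Another nonzero block reaches a fourth one by the previous
     argument, and so does v, whose weight is at least 4, as soon as v != 0.
     If A_m is the only nonzero term, its rank 2 makes up for the missing one.
   So any nonzero tuple of summands gives weight at least 4, which also makes
   the sum direct and yields the dimension. *)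

Require Import Defs.
From mathcomp Require Import all_boot all_order all_algebra all_field.
From mathcomp Require Import zify.
Import Order.TTheory GRing.Theory Num.Theory.
Local Open Scope ring_scope.

Set Implicit Arguments.
Unset Strict Implicit.
Unset Printing Implicit Defensive.

(** * Lower bounds for the flag rank *)

Lemma mxrank_mxsub (F : fieldType) (m n m' n' : nat) (f : 'I_m' -> 'I_m)
    (g : 'I_n' -> 'I_n) (M : 'M[F]_(m, n)) :
  (\rank (mxsub f g M) <= \rank M)%N.
Proof.
rewrite -[M in mxsub _ _ M]mulmx1 mxsub_mul (leq_trans (mxrankM_maxl _ _)) //.
exact/mxrankS/rowsub_sub.
Qed.

Lemma mxrank_mxsub_flag (F : fieldType) (n k l : nat) (M : 'M[F]_n)
    (f : 'I_k -> 'I_n) (g : 'I_l -> 'I_n) (i : 'I_n) :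
    (forall a, f a <= i)%N -> (forall b, i <= g b)%N ->
  (\rank (mxsub f g M) <= \rank (flag_submx M i))%N.
Proof.
move=> fi ig.
have gP b : (g b - i < n - i)%N by rewrite ltn_sub2r ?ltn_ord.
have -> : mxsub f g M = mxsub (fun a => Ordinal (fi a : (f a < i.+1)%N))
    (fun b => Ordinal (gP b)) (flag_submx M i).
  apply/matrixP=> a b; rewrite !mxE; congr (M _ _); apply: val_inj => //=.
  by rewrite subnKC.
exact: mxrank_mxsub.
Qed.

Lemma flag_submx_rank_gt0 (F : fieldType) (n : nat) (M : 'M[F]_n) (r c i : 'I_n) :
  (r <= i <= c)%N -> M r c != 0 -> (0 < \rank (flag_submx M i))%N.
Proof.
case/andP=> ri ic Mrc.
apply: leq_trans (@mxrank_mxsub_flag F n 1 1 M (fun=> r) (fun=> c) i _ _) => //.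
rewrite lt0n mxrank_eq0; apply: contra Mrc => /eqP/matrixP/(_ 0 0).
by rewrite !mxE => ->.
Qed.

(** Lets later arguments pick a few distinct positions, named by plain numbers, and add up the ranks
    there. *)
Lemma leq_flag_rank_seq (F : fieldType) (n : nat) (M : 'M[F]_n.+1) (s : seq nat) :
    uniq s -> all (fun k => k < n.+1)%N s ->
  (\sum_(k <- s) \rank (flag_submx M (inord k)) <= flag_rank M)%N.
Proof.
move=> us /allP ltsn; rewrite -(big_map inord xpredT (fun i => \rank (flag_submx M i))) /=.
rewrite big_uniq /=; last first.
  rewrite map_inj_in_uniq // => x y /ltsn ltxn /ltsn ltyn eqxy.
  by rewrite -(inordK ltxn) eqxy inordK.
by rewrite /flag_rank [leqRHS](bigID (mem [seq inord i | i <- s])) leq_addr.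
Qed.

(** * Dimensions of the summands *)

Lemma dim_upper_mx (F : fieldType) (m : nat) :
  \dim (upper_mx F m) = 'C(m.+1, 2).
Proof.
pose E (p : 'I_m * 'I_m) : 'M[F]_m := delta_mx p.1 p.2.
have E_neq0 p : E p != 0.
  apply/eqP=> /matrixP/(_ p.1 p.2)/eqP; rewrite !mxE !eqxx.
  by rewrite oner_eq0.
have -> : upper_mx F m = (\sum_(p : 'I_m * 'I_m | (p.1 <= p.2)%N) <[E p]>)%VS.
  apply: subv_anti; apply/andP; split; last first.
    apply/subv_sumP=> p lep; rewrite -memvE; apply/upper_mxP=> i j ltji.
    rewrite !mxE; case: eqP => // ip; case: eqP => //= jp.
    by move: lep ltji; rewrite ip jp ltnNge => ->.
  apply/subvP=> A /upper_mxP A0.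
  have -> : A = \sum_(p : 'I_m * 'I_m | (p.1 <= p.2)%N) A p.1 p.2 *: E p.
    rewrite [LHS]matrix_sum_delta pair_big /= (bigID (fun p : 'I_m * 'I_m => p.1 <= p.2)%N) /=.
    rewrite [X in _ + X]big1 ?addr0 // => p; rewrite -ltnNge => /A0 ->.
    by rewrite scale0r.
  by apply: memv_sumr => p _; rewrite memvZ ?memv_line.
have /directvP -> : directv (\sum_(p : 'I_m * 'I_m | (p.1 <= p.2)%N) <[E p]>)%VS.
  apply/directv_sum_independent=> u uE u0 p lep.
  have /vlineP[a ua] := uE p lep.
  (* Only the multiple of [E p] contributes to entry [p] of the vanishing sum. *)
  have /matrixP/(_ p.1 p.2) := u0; rewrite summxE (bigD1 p) //= big1 ?addr0.
    by rewrite ua !mxE !eqxx mulr1 => ->; rewrite scale0r.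
  move=> q /andP[leq /negPf neqp]; have /vlineP[b ->] := uE q leq.
  by rewrite !mxE -xpair_eqE -!surjective_pairing eq_sym neqp mulr0.
rewrite /= (eq_bigr (fun=> 1%N)) => [|p _]; last by rewrite dim_vline E_neq0.
(* The pairs are counted by columns: column [j] contributes [j.+1] of them. *)
rewrite -(pair_big_dep xpredT (fun i j : 'I_m => i <= j)%N (fun _ _ => 1%N)) /=.
rewrite (exchange_big_dep xpredT) //= -bin2_sum big_nat_recl // add0n big_mkord.
apply: eq_bigr => j _.
by rewrite -[RHS]card_ord -sum1_card (big_ord_widen m (fun=> 1%N) (ltn_ord j)).
Qed.

(** Since the block fits, every entry of [A] can be read off its image, so [phi] is injective. *)
Lemma limg_phi_dim (F : fieldType) (l n i j : nat) (V : {vspace 'M[F]_l}) :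
  (i + l <= n)%N -> (j + l <= n)%N -> \dim (phi F l n i j @: V) = \dim V.
Proof.
move=> il jl; apply: limg_dim_eq; apply/eqP; rewrite -subv0.
apply/subvP=> A /memv_capP[_]; rewrite memv_ker memv0 => /eqP/matrixP A0.
apply/eqP/matrixP=> k m; have [ltkl ltml] := (ltn_ord k, ltn_ord m).
have rP : (i + k < n)%N by lia.
have cP : (j + m < n)%N by lia.
have := A0 (Ordinal rP) (Ordinal cP).
by rewrite (@phi_in _ _ _ _ _ _ _ _ k m) // !mxE.
Qed.

(** * Ranks forced by nonzero entries and invertible 2x2 blocks *)

Lemma flag_submx_rank_gt0_inord (F : fieldType) (n : nat) (M : 'M[F]_n.+1) (r c i : nat) :
    (r <= i <= c)%N -> (c < n.+1)%N -> M (inord r) (inord c) != 0 ->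
  (0 < \rank (flag_submx M (inord i)))%N.
Proof.
move=> /andP[ri ic] cn; apply: flag_submx_rank_gt0.
by rewrite !inordK ?ri //; lia.
Qed.

(** Rows [p], [p.+1] and columns [p.+1], [p.+2] all lie in the flag submatrix at [p.+1], and in no
    other one. *)
Lemma flag_submx_rank_ge2 (F : fieldType) (n : nat) (M : 'M[F]_n.+1) (p : nat)
    (B : 'M[F]_2) :
    (p.+2 < n.+1)%N -> B \in unitmx ->
    (forall k m : 'I_2, M (inord (p + k)) (inord (p.+1 + m)) = B k m) ->
  (2 <= \rank (flag_submx M (inord p.+1)))%N.
Proof.
move=> pn uB MB; rewrite -(mxrank_unit uB).
have -> : B = mxsub (fun k : 'I_2 => inord (p + k)) (fun m : 'I_2 => inord (p.+1 + m)) M.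
  by apply/matrixP=> k m; rewrite mxE MB.
by apply: mxrank_mxsub_flag => k; have ltk2 := ltn_ord k; rewrite !inordK; lia.
Qed.

Lemma unitmx2_corner0 (F : fieldType) (B : 'M[F]_2) :
  B 0 1 = 0 -> (B \in unitmx) = (B 0 0 != 0) && (B 1 1 != 0).
Proof.
move=> B01; rewrite unitmxE unitfE det_trig.
  by rewrite big_ord_recl big_ord1 mulf_eq0 negb_or; congr (_ && (B _ _ != 0)); apply: val_inj.
apply/is_trig_mxP => i j ij; have ->: i = 0 by apply: val_inj => /=; have := ltn_ord j; lia.
have ->: j = 1 by apply: val_inj => /=; have := ltn_ord j; lia.
exact: B01.
Qed.

(** * Entries of a sum of 2x2 blocks, a diagonal matrix and a far upper part *)

Section Weight.

Variables (F : fieldType) (n : nat).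
Variables (A : 'I_(n.+1 - 2) -> 'M[F]_2) (v : 'rV[F]_n.+1) (W : 'M[F]_n.+1).
Hypothesis A_unit : forall i, A i != 0 -> A i \in unitmx.
Hypothesis v_weight : v != 0 -> (4 <= hamming_weight v)%N.
Hypothesis W_far : forall r c : 'I_n.+1, (c < r + 3)%N -> W r c = 0.

Let S := \sum_(i < n.+1 - 2) phi F 2 n.+1 i i.+1 (A i).
Let M := S + diag_mx v + W.

(** Only nonzero blocks have to avoid the position; this is what makes the first and last nonzero
    blocks readable. *)
Lemma block_sum_entry (i : 'I_(n.+1 - 2)) (k m : 'I_2) :
    (forall j : 'I_(n.+1 - 2), j != i -> A j != 0 ->
      ~~ ((j <= i + k < j + 2) && (j.+1 <= i.+1 + m < j.+1 + 2))%N) ->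
  S (inord (i + k)) (inord (i.+1 + m)) = A i k m.
Proof.
have [[ltin ltk] ltm] := (ltn_ord i, ltn_ord k, ltn_ord m).
move=> out; rewrite summxE (bigD1 i) //= big1 ?addr0 => [|j ji].
  by rewrite (@phi_in _ _ _ _ _ _ _ _ k m) // inordK //; lia.
have [->|Aj] := eqVneq (A j) 0; first by rewrite linear0 mxE.
rewrite phi_out // !inordK; try lia.
exact: out.
Qed.

Lemma M_off_diag (r c : nat) : (r < c < r + 3)%N -> (c < n.+1)%N ->
  M (inord r) (inord c) = S (inord r) (inord c).
Proof.
move=> rc cn; rewrite !mxE W_far ?addr0; last by rewrite !inordK; lia.
case: eqP => [/(congr1 (@nat_of_ord _))|_]; last by rewrite addr0.
by rewrite !inordK; lia.
Qed.

Lemma M_corner (i : 'I_(n.+1 - 2)) : M (inord i) (inord i.+2) = A i 0 1.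
Proof.
have ltin := ltn_ord i.
rewrite M_off_diag; try lia.
have := @block_sum_entry i 0 1; rewrite /= addn0 addn1 => -> // j.
by rewrite -(inj_eq val_inj) /=; lia.
Qed.

(** Block [i - 1] is the only other one covering this position, and minimality makes it zero.
    [M_last] is symmetric, with block [i + 1]. *)
Lemma M_first (i : 'I_(n.+1 - 2)) :
  (forall j : 'I_(n.+1 - 2), A j != 0 -> (i <= j)%N) ->
  M (inord i) (inord i.+1) = A i 0 0.
Proof.
have ltin := ltn_ord i.
move=> minA; rewrite M_off_diag; try lia.
have := @block_sum_entry i 0 0; rewrite /= !addn0 => -> // j.
by rewrite -(inj_eq val_inj) /= => ? /minA; lia.
Qed.

Lemma M_last (i : 'I_(n.+1 - 2)) :
  (forall j : 'I_(n.+1 - 2), A j != 0 -> (j <= i)%N) ->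
  M (inord i.+1) (inord i.+2) = A i 1 1.
Proof.
have ltin := ltn_ord i.
move=> maxA; rewrite M_off_diag; try lia.
have := @block_sum_entry i 1 1; rewrite /= !addn1 => -> // j.
by rewrite -(inj_eq val_inj) /= => ? /maxA; lia.
Qed.

Lemma M_far (r c : 'I_n.+1) : (r + 3 <= c)%N -> M r c = W r c.
Proof.
move=> rc; rewrite !mxE; case: eqP => [rE|_]; first by move: rc; rewrite rE; lia.
rewrite addr0 summxE big1 ?add0r // => j _.
by rewrite phi_out //; lia.
Qed.

(** Block [j] meets the diagonal only in its lower left entry, at position [j.+1]. *)
Lemma M_diag (r : 'I_n.+1) :
    (forall j : 'I_(n.+1 - 2), A j != 0 -> r != j.+1 :> nat) ->
  M r r = v 0 r.
Proof.
move=> out; rewrite !mxE eqxx W_far ?addr0; last by lia.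
rewrite summxE big1 ?add0r // => j _.
have [->|/out Aj] := eqVneq (A j) 0; first by rewrite linear0 mxE.
by rewrite phi_out //; lia.
Qed.

Let fr k := \rank (flag_submx M (inord k)).

Lemma four_ranks (a b c d : nat) :
    uniq [:: a; b; c; d] -> all (fun k => k < n.+1)%N [:: a; b; c; d] ->
  (0 < fr a)%N -> (0 < fr b)%N -> (0 < fr c)%N -> (0 < fr d)%N -> (4 <= flag_rank M)%N.
Proof.
move=> us ltn; have := leq_flag_rank_seq M us ltn.
rewrite !big_cons big_nil -/(fr a) -/(fr b) -/(fr c) -/(fr d); lia.
Qed.

Lemma three_ranks (p : nat) : (p.+2 < n.+1)%N ->
  (0 < fr p)%N -> (2 <= fr p.+1)%N -> (0 < fr p.+2)%N -> (4 <= flag_rank M)%N.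
Proof.
move=> pn; have := @leq_flag_rank_seq _ _ M [:: p; p.+1; p.+2].
rewrite !big_cons big_nil -/(fr p) -/(fr p.+1) -/(fr p.+2) /= !inE; lia.
Qed.

(** * Weight below 4 forces every term to vanish *)

Hypothesis M_light : (flag_rank M < 4)%N.

Lemma light_W0 : W = 0.
Proof.
apply/matrixP=> r c; rewrite mxE; have [/W_far //|rc] := ltnP c (r + 3).
apply: contraTeq M_light => Wrc; rewrite -leqNgt.
have ltc := ltn_ord c.
apply: (@four_ranks r r.+1 r.+2 c); rewrite /= ?inE; try lia;
  apply: (@flag_submx_rank_gt0_inord _ _ _ r c); rewrite ?inord_val ?M_far //; lia.
Qed.

Lemma light_A0 (i : 'I_(n.+1 - 2)) : A i = 0.
Proof.
apply: contraTeq M_light => Ai; rewrite -leqNgt.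
have ltin := ltn_ord i.
(* [p] and [q] are the first and the last nonzero block. *)
have [p Ap minA] := @arg_minnP _ i (fun j => A j != 0) (@nat_of_ord _) Ai.
have [q Aq maxA] := @arg_maxnP _ i (fun j => A j != 0) (@nat_of_ord _) Ai.
have [ltpn ltqn] := (ltn_ord p, ltn_ord q).
have lepq : (p <= q)%N := minA q Aq.
have corner_rank j k : A j 0 1 != 0 -> (j <= k <= j.+2)%N -> (0 < fr k)%N.
  move=> Aj01 jk; have ltj := ltn_ord j.
  by apply: (@flag_submx_rank_gt0_inord _ _ _ j j.+2); rewrite ?M_corner //; lia.
have first_rank k : A p 0 0 != 0 -> (p <= k <= p.+1)%N -> (0 < fr k)%N.
  move=> Ap00 pk; apply: (@flag_submx_rank_gt0_inord _ _ _ p p.+1); rewrite ?M_first //; lia.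
have last_rank k : A q 1 1 != 0 -> (q.+1 <= k <= q.+2)%N -> (0 < fr k)%N.
  move=> Aq11 qk; apply: (@flag_submx_rank_gt0_inord _ _ _ q.+1 q.+2); rewrite ?M_last //; lia.
have ends j : A j 0 1 = 0 -> A j != 0 -> (A j 0 0 != 0) /\ (A j 1 1 != 0).
  by move=> Aj01 /A_unit; rewrite unitmx2_corner0 // => /andP.
have [m Am|A01] := pickP (fun j => A j 0 1 != 0); last first.
  have [Ap00 _] := ends p (eqP (negbFE (A01 p))) Ap.
  have [_ Aq11] := ends q (eqP (negbFE (A01 q))) Aq.
  have [eqpq|ltpq] := eqVneq p q.
    subst q; apply: (@three_ranks p); try lia.
    - by apply: first_rank => //; lia.
    - pose B := mxsub (fun k : 'I_2 => inord (p + k)) (fun m : 'I_2 => inord (p.+1 + m)) M.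
      have BE k m : B k m = M (inord (p + k)) (inord (p.+1 + m)) by rewrite [LHS]mxE.
      apply: (@flag_submx_rank_ge2 _ _ _ p B) => //; first lia.
      rewrite unitmx2_corner0 !BE /= ?addn0 ?addn1 ?M_corner ?M_first ?M_last ?Ap00 //.
      exact/eqP/negbFE/A01.
    - by apply: last_rank => //; lia.
  rewrite -(inj_eq val_inj) /= in ltpq.
  apply: (@four_ranks p p.+1 q.+1 q.+2); rewrite /= ?inE; try lia.
  1,2: by apply: first_rank => //; lia.
  1,2: by apply: last_rank => //; lia.
have ltmn := ltn_ord m.
(* The corner of [A m] accounts for [m], [m.+1] and [m.+2], so one positive rank outside this range
   suffices. *)
have fourth k : (k < n.+1)%N -> (k < m)%N || (m.+2 < k)%N -> (0 < fr k)%N -> (4 <= flag_rank M)%N.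
  move=> ltk km frk; apply: (@four_ranks m m.+1 m.+2 k) => //=; rewrite ?inE; try lia;
    apply: (corner_rank m) => //; lia.
have [j /andP[jm Aj01]|A01] := pickP (fun j => (j != m) && (A j 0 1 != 0)).
  rewrite -(inj_eq val_inj) /= in jm; have ltj := ltn_ord j.
  have [ltjm|lemj] := ltnP j m.
    apply: (fourth j); [lia | lia | apply: (corner_rank j) => //; lia].
  apply: (fourth j.+2); [lia | lia | apply: (corner_rank j) => //; lia].
have off01 j : j != m -> A j 0 1 = 0 by move=> jm; have := A01 j; rewrite jm => /eqP.
(* A first nonzero block other than [m] precedes it and has zero corner, so its upper left entry
   gives the fourth rank at [p]. The last block is treated likewise. *)
have [pm|pm] := eqVneq p m; last first.
  have [Ap00 _] := ends p (off01 p pm) Ap.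
  have := minA m; rewrite -(inj_eq val_inj) /= in pm.
  have -> : A m != 0 by apply: contraNneq Am => ->; rewrite mxE.
  move=> /(_ isT) lepm; apply: (fourth p); [lia | lia | apply: first_rank => //; lia].
have [qm|qm] := eqVneq q m; last first.
  have [_ Aq11] := ends q (off01 q qm) Aq.
  rewrite -(inj_eq val_inj) /= in qm; subst m.
  apply: (fourth q.+2); [lia | lia | apply: last_rank => //; lia].
subst p q.
have only_m j : A j != 0 -> j = m :> nat by move=> Aj; have := minA j Aj; have := maxA j Aj; lia.
have [r /andP[rm vr]|v_near] := pickP (fun r : 'I_n.+1 => ((r < m)%N || (m.+2 < r)%N) && (v 0 r != 0)).
  apply: (fourth r) => //; apply: (@flag_submx_rank_gt0_inord _ _ _ r r); rewrite ?leqnn //.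
  by rewrite inord_val M_diag // => j /only_m ->; lia.
have v0 : v = 0.
  apply: contraTeq isT => /v_weight; rewrite leqNgt => /negP[].
  (* At most three coordinates of [v] can be nonzero, which contradicts weight at least 4. *)
  have sub : [set j | v 0 j != 0] \subset [set inord m; inord m.+1; inord m.+2].
    apply/subsetP=> r; rewrite !inE => vr; have := v_near r; rewrite vr andbT.
    by rewrite -!(inj_eq val_inj) /= !inordK; lia.
  apply: leq_ltn_trans (subset_leq_card sub) _; rewrite -setUA cardsU1 cards2; lia.
apply: (@three_ranks m); [lia | apply: (corner_rank m) => //; lia | | apply: (corner_rank m) => //; lia].
apply: (@flag_submx_rank_ge2 _ _ _ m (A m)); [lia | by apply: A_unit | move=> k l].
(* With [v] and [W] gone, the window of [M] is exactly [A m]. *)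
rewrite /M v0 light_W0 addr0 raddf0 addr0 block_sum_entry // => j jm /only_m jE.
by case/eqP: jm; apply: val_inj.
Qed.

(** Once the blocks vanish, the diagonal of [M] is [v], and each nonzero coordinate gives a nonzero
    rank at its own index. *)
Lemma light_v0 : v = 0.
Proof.
apply: contraTeq M_light => /v_weight wv; rewrite -leqNgt (leq_trans wv) //.
rewrite /hamming_weight -sum1_card /flag_rank big_mkcond /=; apply: leq_sum => r _.
case: ifP => //; rewrite inE => vr; apply: (@flag_submx_rank_gt0 _ _ _ r r); rewrite ?leqnn //.
by rewrite M_diag // => j; rewrite light_A0 eqxx.
Qed.

End Weight.

(** * Matrix units: placement and weight *)

Lemma phi_delta (F : fieldType) (l n i j : nat) (k m : 'I_l) (r c : 'I_n) :
  r = (i + k)%N :> nat -> c = (j + m)%N :> nat ->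
  phi F l n i j (delta_mx k m) = delta_mx r c.
Proof.
move=> rE cE; apply/matrixP=> r' c'; rewrite lfunE !mxE.
under eq_bigr => k' _ do under eq_bigr => m' _ do rewrite mxE.
rewrite (bigD1 k) //= [X in _ + X]big1 ?addr0 => [|k' /negPf nk]; last first.
  by rewrite big1 // => m' _; rewrite nk.
rewrite big_mkcond (bigD1 m) //= big1 ?addr0 => [|m' /negPf nm]; last first.
  by rewrite nm andbF; case: ifP.
by rewrite !eqxx -rE -cE (eq_sym r') (eq_sym c') !(inj_eq val_inj); case: ifP.
Qed.

(** The submatrices at [i > c] vanish and the others have rank at most 1. For [r <= c] the exact
    weight is [c - r + 1], so the bound is sharp at [r = 0]. *)
Lemma flag_rank_delta_le (F : fieldType) (n : nat) (r c : 'I_n) :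
  (flag_rank (delta_mx r c : 'M[F]_n) <= c.+1)%N.
Proof.
have -> : c.+1 = (\sum_(i < n) (i < c.+1))%N.
  by rewrite -big_mkcond -(big_ord_widen n (fun=> 1%N)) // sum1_card card_ord.
apply: leq_sum => i _; rewrite /flag_submx; case: ltnP => [_|ltci].
  by rewrite (leq_trans (mxrank_mxsub _ _ _)) // mxrank_delta.
rewrite leqn0 mxrank_eq0; apply/eqP/matrixP=> a b; rewrite !mxE.
case: (_ =P c) => [/(congr1 (@nat_of_ord _)) /= cE|_]; last by rewrite andbF.
by move: ltci; rewrite -cE; lia.
Qed.

(** * Dimension and minimum weight of the code *)

Section Code.

Variables (F : fieldType) (n : nat).
Variables (C : 'I_(n.+1 - 2) -> {vspace 'M[F]_2}) (D : {vspace 'rV[F]_n.+1}).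
Hypothesis hn : (4 <= n.+1)%N.
Hypothesis hC : forall i : 'I_(n.+1 - 2), mrd_2x2_2_2 (C i).
Hypothesis hD : mds_code (n.+1 - 3) 4 D.

Let B (i : 'I_(n.+1 - 2)) := (phi F 2 n.+1 i i.+1 @: C i)%VS.
Let T := (\sum_(i < n.+1 - 2) B i)%VS.
Let Dg := (psi F n.+1 @: D)%VS.
Let U := (phi F (n.+1 - 3) n.+1 0 3 @: upper_mx F (n.+1 - 3))%VS.

Lemma upper_block_far (z : 'M[F]_n.+1) (r c : 'I_n.+1) :
  z \in U -> (c < r + 3)%N -> z r c = 0.
Proof.
case/memv_imgP=> u /upper_mxP uU -> cr; have [ltr ltc] := (ltn_ord r, ltn_ord c).
have [/andP[rn c3]|out] := boolP ((r < n.+1 - 3) && (3 <= c))%N; last first.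
  by rewrite phi_out //; lia.
have cP : (c - 3 < n.+1 - 3)%N by lia.
by rewrite (@phi_in _ _ _ _ _ _ _ _ (Ordinal rn) (Ordinal cP)) ?uU //=; lia.
Qed.

(** Gives the minimum weight and, applied to sums equal to 0, the directness of the sum. *)
Lemma light_terms (u : 'I_(n.+1 - 2) -> 'M[F]_n.+1) (y z : 'M[F]_n.+1) :
    (forall i, u i \in B i) -> y \in Dg -> z \in U ->
    (flag_rank (\sum_i u i + y + z) < 4)%N ->
  [/\ forall i, u i = 0, y = 0 & z = 0].
Proof.
move=> uB /memv_imgP[v vD ->] zU.
have /fin_all_exists2[A AC uE] : forall i, exists2 a, a \in C i & u i = phi F 2 n.+1 i i.+1 a.
  by move=> i; apply/memv_imgP/uB.
rewrite (eq_bigr _ (fun i _ => uE i)) lfunE /= => light.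
have A_unit i : A i != 0 -> A i \in unitmx by case: (hC i) => _; apply.
have v_weight : v != 0 -> (4 <= hamming_weight v)%N by case: hD => _ _; apply.
have far r c := @upper_block_far z r c zU.
split=> [i||].
- by rewrite uE (light_A0 A_unit v_weight far light) linear0.
- by rewrite (light_v0 A_unit v_weight far light) linear0.
- exact: light_W0 far light.
Qed.

Lemma flag_rank0 : flag_rank (0 : 'M[F]_n.+1) = 0%N.
Proof.
by rewrite /flag_rank big1 // => i _; rewrite /flag_submx linear0 mxrank0.
Qed.

Lemma code_dim : \dim (T + Dg + U) = ((n.+1 * n.+2) %/ 2 - 4)%N.
Proof.
have Tdir : directv T.
  apply/directv_sum_independent=> u uB u0 i _.
  have [] := @light_terms u 0 0 (fun i => uB i isT) (mem0v _) (mem0v _) => //.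
  by rewrite u0 !addr0 flag_rank0.
have TD0 : (T :&: Dg = 0)%VS.
  apply/eqP; rewrite -subv0; apply/subvP=> x /memv_capP[/memv_sumP[u uB xE] xD].
  rewrite memv0; have [] := @light_terms u (- x) 0 (fun i => uB i isT) _ (mem0v _).
  - by rewrite memvN.
  - by rewrite -xE subrr addr0 flag_rank0.
  by move=> _ /eqP; rewrite oppr_eq0.
have TDU0 : ((T + Dg) :&: U = 0)%VS.
  apply/eqP; rewrite -subv0; apply/subvP=> x /memv_capP[/memv_addP[t /memv_sumP[u uB ->]] [y yD xE] xU].
  rewrite memv0; have [] := @light_terms u y (- x) (fun i => uB i isT) yD.
  - by rewrite memvN.
  - by rewrite -xE subrr flag_rank0.
  by move=> _ _ /eqP; rewrite oppr_eq0.
rewrite !dimv_disjoint_sum // (directvP Tdir) /= (eq_bigr (fun=> 2%N)); last first.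
  move=> i _; have ltin := ltn_ord i.
  by rewrite limg_phi_dim; [case: (hC i) | lia | lia].
rewrite sum_nat_const card_ord limg_phi_dim ?dim_upper_mx; try lia.
have -> : \dim Dg = (n.+1 - 3)%N.
  have [_ <- _] := hD; apply: limg_dim_eq; apply/eqP; rewrite -subv0.
  apply/subvP=> w /memv_capP[_]; rewrite memv_ker memv0 lfunE /= => /eqP/matrixP w0.
  by apply/eqP/rowP=> j; have := w0 j j; rewrite !mxE eqxx.
have -> : ((n.+1 * n.+2) %/ 2 = 'C(n.+2, 2))%N by rewrite bin2 divn2 mulnC.
(* With [N = n.+1], it remains to see that 2(N-2) + (N-3) + C(N-2,2) = C(N+1,2) - 4, by Pascal's
   rule. *)
case: n hn => [|[|[|k]]] // _.
by rewrite !subSS !subn0 !binS !bin1 !bin0; lia.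
Qed.

Lemma code_sub_upper : (T + Dg + U <= upper_mx F n.+1)%VS.
Proof.
rewrite !subv_add; apply/andP; split; first (apply/andP; split).
- apply/subv_sumP=> i _; apply/subvP=> x /memv_imgP[a _ ->]; apply/upper_mxP=> r c cr.
  by rewrite phi_out //; lia.
- apply/subvP=> x /memv_imgP[v _ ->]; apply/upper_mxP=> r c cr.
  by rewrite lfunE !mxE /= -(inj_eq val_inj) gtn_eqF.
- apply/subvP=> x xU; apply/upper_mxP=> r c cr; apply: upper_block_far xU _; lia.
Qed.

Lemma code_min_weight (M : 'M[F]_n.+1) :
  M \in (T + Dg + U)%VS -> M != 0 -> (4 <= flag_rank M)%N.
Proof.
case/memv_addP=> _ /memv_addP[_ /memv_sumP[u uB ->] [y yD ->]] [z zU ->].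
apply: contraNT; rewrite -ltnNge => light.
have [u0 -> ->] := light_terms (fun i => uB i isT) yD zU light.
by rewrite big1 ?addr0.
Qed.

Lemma code_weight4 : exists M,
  [/\ M \in (T + Dg + U)%VS, M != 0 & flag_rank M = 4%N].
Proof.
have n3 : (0 < n.+1 - 3)%N by lia.
(* The witness is the matrix unit at (0, 3), the top left corner of the far block: it meets exactly
   the flag submatrices 0 to 3. *)
pose o := Ordinal n3.
have E : phi F (n.+1 - 3) n.+1 0 3 (delta_mx o o) = delta_mx (inord 0) (inord 3).
  by apply: phi_delta; rewrite /= inordK; lia.
have inC : delta_mx (inord 0) (inord 3) \in (T + Dg + U)%VS.
  rewrite -E -[phi _ _ _ _ _ _]add0r memv_add ?mem0v //; apply/memv_img/upper_mxP=> i j ji.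
  rewrite mxE; case: eqP => // iE; by rewrite iE in ji.
have neq0 : delta_mx (inord 0) (inord 3) != 0 :> 'M[F]_n.+1.
  by apply/eqP=> /matrixP/(_ (inord 0) (inord 3))/eqP; rewrite !mxE !eqxx oner_eq0.
exists (delta_mx (inord 0) (inord 3)); split=> //.
apply/eqP; rewrite eqn_leq code_min_weight // andbT.
by rewrite (leq_trans (flag_rank_delta_le _ _ _)) // inordK.
Qed.

End Code.

Theorem theorem4p26 (F : fieldType) (n : nat) (hn : (4 <= n)%N)
    (C : 'I_(n - 2) -> {vspace 'M[F]_2}) (D : {vspace 'rV[F]_n})
    (hC : forall i : 'I_(n - 2), mrd_2x2_2_2 (C i))
    (hD : mds_code (n - 3) 4 D) :
  mfrd_code ((n * n.+1) %/ 2 - 4) 4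
    (\sum_(i < n - 2) (phi F 2 n i i.+1 @: C i)
     + (psi F n @: D)
     + (phi F (n - 3) n 0 3 @: upper_mx F (n - 3)))%VS.
Proof.
case: n => [|n] // in hn C D hC hD *; split; last first.
  (* Ensures that subtracting 4 from the halved product is not truncated. *)
  have : (4 * 4 <= n.+1 * n.+2)%N by apply: leq_mul; lia.
  by rewrite g4; lia.
split; [exact: code_sub_upper | exact: code_dim | exact: code_min_weight | exact: code_weight4].
Qed.
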